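(* Let $\ell \geqslant 1$ be an integer, $p\geqslant 2$ a prime number, $q=p^{s}$ and $r=p^{t}$ with $s,t\geqslant 1$ integers. Let $k\geqslant 1$ be an integer dividing $r$. Let $(\lambda_{1},\lambda_{2},\ldots,\lambda_{\ell})$ be a given $\ell$-tuple in $(\mathbb{F}_{q})^{\ell}$. Let $\alpha_{1},\ldots,\alpha_{k}\in\mathbb{F}_{q}^{*}$ and $\beta_{1},\ldots,\beta_{r-1}\in\mathbb{F}_{q}$ be fixed elements. Define recursively the sequence $(\lambda_{n})_{n\geqslant 1}$ in $\mathbb{F}_{q}$ as follows: for all integers $m\geqslant 0$, $$\lambda_{\ell+1+r(km+i)}=\alpha_{i+1}\,\lambda_{km+i+1}^{r}\quad\text{for } 0\leqslant i<k,$$ $$\lambda_{\ell+1+rm+j}=\beta_{j}\quad\text{for } 1\leqslant j<r.$$ Set $\theta=\sum_{n\geqslant 1}\lambda_{n}T^{-n}\in\mathbb{F}(q)$. Then there exist $A,B,C\in\mathbb{F}_{q}(T)$, with $C\neq 0$, and $\rho\in\mathbb{F}(q)$ such that $$\theta=A+\rho\quad\text{and}\quad \rho=B+C\rho^{r}.$$ Hence $\theta$ is algebraic over $\mathbb{F}_{q}(T)$, and the sequence $(\lambda_{n})_{n\geqslant 1}$ is $p$-automatic.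
   Context: $\mathbb{F}_{q}$ is the finite field with $q$ elements, $T$ is a formal indeterminate, and $\mathbb{F}(q)$ denotes the field of formal power series in $1/T$ with coefficients in $\mathbb{F}_{q}$, i.e. the elements $\sum_{k\leqslant k_{0}}u(k)T^{k}$ with $k_{0}\in\mathbb{Z}$ and $u(k)\in\mathbb{F}_{q}$ (that is, $\mathbb{F}_q((1/T))$); it contains $\mathbb{F}_{q}(T)$. For an integer $r\geqslant 2$, a sequence $v=(v(n))_{n\geqslant 1}$ with values in a finite set is called $r$-automatic if its $r$-kernel $K_{r}(v)=\{(v(r^{i}n+j))_{n\geqslant 1}\mid i\geqslant 0,\ 0\leqslant j<r^{i}\}$ is a finite set of sequences; $p$-automatic means this with $p$ in place of $r$. *)

(* Defs.v *)
From HB Require Import structures.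
From mathcomp Require Import all_boot all_order all_algebra.
From mathcomp Require Import generic_quotient.
From mathcomp Require Import zify.
From mathcomp Require Import boolp classical_sets cardinality fsbigop.

Set Implicit Arguments.
Unset Strict Implicit.
Unset Printing Implicit Defensive.

Import Order.TTheory GRing.Theory Num.Theory.
Local Open Scope ring_scope.

(* [laurent F] is the field F((1/T)): the formal series sum_k (u k) T^k over
   k : int whose coefficients vanish for all k larger than some k0. *)
Record laurent (F : fieldType) := Laurent {
  lcoef :> int -> F;
  lcoef_bounded : exists k0 : int, forall k : int, k0 < k -> lcoef k = 0 }.

HB.instance Definition _ (F : fieldType) := gen_eqMixin (laurent F).
HB.instance Definition _ (F : fieldType) := gen_choiceMixin (laurent F).

Section LaurentField.
Variable F : fieldType.
Implicit Types (u v w : laurent F) (k : int).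

Lemma laurentP u v : (forall k, u k = v k) -> u = v.
Proof.
case: u v => [u up] [v vp] /= uv.
have e : u = v by apply/funext.
by case: _ / e vp => vp; congr Laurent; exact: Prop_irrelevance.
Qed.

Definition lbound (a : int) (f : int -> F) := forall k, a < k -> f k = 0.

Lemma lboundW a b f : a <= b -> lbound a f -> lbound b f.
Proof. by move=> ab fa k bk; apply: fa; exact: le_lt_trans bk. Qed.

Lemma laurent_eqP a u v : lbound a u -> lbound a v ->
  (forall n : nat, u (a - n%:Z) = v (a - n%:Z)) -> u = v.
Proof.
move=> ua va uv; apply: laurentP => k.
have [ak|ka] := ltP a k; first by rewrite ua// va.
have -> : k = a - `|a - k|%N%:Z; last exact: uv.
by rewrite gez0_abs ?subr_ge0// opprB addrC subrK.
Qed.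

Lemma lzero_bounded : exists k0 : int, lbound k0 (fun=> 0).
Proof. by exists 0. Qed.
Definition lzero := Laurent lzero_bounded.

Lemma lopp_bounded u : exists k0 : int, lbound k0 (fun k => - u k).
Proof. by have [a ua] := lcoef_bounded u; exists a => k /ua ->; rewrite oppr0. Qed.
Definition lopp u := Laurent (lopp_bounded u).

Lemma lbound2 u v : exists a, lbound a u /\ lbound a v.
Proof.
have [a ua] := lcoef_bounded u; have [b vb] := lcoef_bounded v.
exists (Order.max a b); split.
  by apply: lboundW ua; rewrite le_max lexx.
by apply: lboundW vb; rewrite le_max lexx orbT.
Qed.

Lemma ladd_bounded u v : exists k0 : int, lbound k0 (fun k => u k + v k).
Proof.
by have [a [ua va]] := lbound2 u v; exists a => k ak; rewrite ua// va// addr0.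
Qed.
Definition ladd u v := Laurent (ladd_bounded u v).

Fact laddA : associative ladd.
Proof. by move=> u v w; apply: laurentP => k /=; rewrite addrA. Qed.
Fact laddC : commutative ladd.
Proof. by move=> u v; apply: laurentP => k /=; rewrite addrC. Qed.
Fact ladd0 : left_id lzero ladd.
Proof. by move=> u; apply: laurentP => k /=; rewrite add0r. Qed.
Fact laddN : left_inverse lzero lopp ladd.
Proof. by move=> u; apply: laurentP => k /=; rewrite addNr. Qed.

HB.instance Definition _ :=
  GRing.isZmodule.Build (laurent F) laddA laddC ladd0 laddN.

(* Cauchy product; for fixed k only finitely many terms are nonzero. *)
Definition lmul_coef u v (k : int) : F :=
  \sum_(i \in [set: int]) u i * v (k - i).

Lemma lmul_bound a b u v : lbound a u -> lbound b v ->
  lbound (a + b) (lmul_coef u v).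
Proof.
move=> ua vb k abk; apply: fsbig1 => i _.
have [/ua ->|ia] := ltP a i; first by rewrite mul0r.
by rewrite vb ?mulr0// ltrBrDl (le_lt_trans _ abk)// lerD2r.
Qed.

Lemma lmul_bounded u v : exists k0 : int, lbound k0 (lmul_coef u v).
Proof.
have [a ua] := lcoef_bounded u; have [b vb] := lcoef_bounded v.
by exists (a + b); exact: lmul_bound.
Qed.
Definition lmul u v := Laurent (lmul_bounded u v).

Lemma lmulE a b u v n : lbound a u -> lbound b v ->
  lmul_coef u v (a + b - n%:Z) =
  \sum_(i < n.+1) u (a - i%:Z) * v (b - (n - i)%N%:Z).
Proof.
move=> ua vb; have e0 i : (i <= n)%N -> a + b - n%:Z - (a - i%:Z) = b - (n - i)%N%:Z.
  by move=> le_in; lia.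
pose s := [seq a - i%:Z | i <- iota 0 n.+1].
have us : uniq s by rewrite map_inj_uniq ?iota_uniq// => i j; lia.
rewrite /lmul_coef (fsbigE s)//.
  rewrite (eq_bigl xpredT) => [|i]; last by rewrite in_setT.
  have -> : s = [seq a - i%:Z | i <- index_iota 0 n.+1] by rewrite /index_iota subn0.
  rewrite big_map big_mkord.
  by apply: eq_bigr => i _; rewrite e0// -ltnS.
move=> i _ ni; have [/ua ->|ia] := ltP a i; first by rewrite mul0r.
rewrite vb ?mulr0// ltNge; apply: contra ni => le_b.
apply/mapP; exists `|a - i|%N; last by lia.
by rewrite mem_iota; lia.
Qed.

Definition ltrunc (a : int) N u : {poly F} := \poly_(i < N) u (a - i%:Z).

Lemma lmul_coefM a b u v n N : lbound a u -> lbound b v -> (n < N)%N ->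
  lmul_coef u v (a + b - n%:Z) = (ltrunc a N u * ltrunc b N v)`_n.
Proof.
move=> ua vb nN; rewrite (lmulE _ ua vb) coefM; apply: eq_bigr => i _.
by rewrite !coef_poly !ifT//; have := ltn_ord i; lia.
Qed.

Fact lmulC : commutative lmul.
Proof.
move=> u v; have [a ua] := lcoef_bounded u; have [b vb] := lcoef_bounded v.
apply: (@laurent_eqP (a + b)); first exact: lmul_bound.
  by rewrite addrC; exact: lmul_bound.
move=> n /=; rewrite (lmul_coefM ua vb (ltnSn n)) [a + b]addrC.
by rewrite (lmul_coefM vb ua (ltnSn n)) mulrC.
Qed.

Fact lmulA : associative lmul.
Proof.
move=> u v w; have [a ua] := lcoef_bounded u; have [b vb] := lcoef_bounded v.
have [c wc] := lcoef_bounded w.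
have uvb : lbound (a + b) (lmul u v) by exact: lmul_bound.
have vwb : lbound (b + c) (lmul v w) by exact: lmul_bound.
apply: (@laurent_eqP (a + (b + c))); first exact: lmul_bound.
  by rewrite addrA; exact: lmul_bound.
move=> n /=; transitivity (ltrunc a n.+1 u * (ltrunc b n.+1 v * ltrunc c n.+1 w))`_n.
  rewrite (lmulE _ ua vwb) coefM; apply: eq_bigr => i _.
  have := ltn_ord i => lt_i; rewrite coef_poly lt_i; congr (_ * _).
  by rewrite -(lmul_coefM vb wc)//; lia.
rewrite mulrA addrA (lmulE _ uvb wc) coefM; apply: eq_bigr => i _.
have := ltn_ord i => lt_i; rewrite [(ltrunc c _ _)`__]coef_poly ifT; last by lia.
by congr (_ * _); rewrite -(lmul_coefM ua vb).
Qed.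

Fact lmulDl : left_distributive lmul ladd.
Proof.
move=> u v w; have [a [ua va]] := lbound2 u v; have [c wc] := lcoef_bounded w.
have uva : lbound a (ladd u v) by move=> k ak /=; rewrite ua// va// addr0.
apply: (@laurent_eqP (a + c)); first exact: lmul_bound.
  by move=> k ak /=; rewrite (lmul_bound ua wc)// (lmul_bound va wc)// addr0.
move=> n /=; rewrite (lmulE _ uva wc) (lmulE _ ua wc) (lmulE _ va wc) -big_split.
by apply: eq_bigr => i _; rewrite mulrDl.
Qed.

(* The image of a polynomial p in F[T]. *)
Definition lpoly_coef (p : {poly F}) (k : int) : F :=
  if k is Posz n then p`_n else 0.

Lemma lpoly_bounded p : exists k0 : int, lbound k0 (lpoly_coef p).
Proof.
exists (size p)%:Z => -[k|//] /= pk.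
by rewrite nth_default//; apply: ltnW.
Qed.
Definition lpoly p := Laurent (lpoly_bounded p).

Fact lmul1 : left_id (lpoly 1) lmul.
Proof.
move=> u; have [a ua] := lcoef_bounded u.
have b1 : lbound 0 (lpoly 1) by case=> [[|k]|k]//= _; rewrite coef1.
have b1u : lbound a (lmul (lpoly 1) u) by rewrite -[a]add0r; exact: lmul_bound.
apply: (@laurent_eqP a) => // n /=.
rewrite -[a in LHS]add0r (lmulE _ b1 ua) big_ord_recl /= coef1 mul1r subn0.
by rewrite big1 ?addr0// => i _; rewrite mul0r.
Qed.

Fact lone_neq0 : lpoly 1 != lzero.
Proof.
apply/eqP => /(congr1 (fun u : laurent F => u 0)) /= /eqP.
by rewrite coef1 oner_eq0.
Qed.

HB.instance Definition _ := GRing.Zmodule_isComNzRing.Build (laurent F)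
  lmulA lmulC lmul1 lmulDl lone_neq0.

Lemma lcoefD u v k : (u + v) k = u k + v k. Proof. by []. Qed.
Lemma lcoefN u k : (- u) k = - u k. Proof. by []. Qed.
Lemma lcoef0 k : (0 : laurent F) k = 0. Proof. by []. Qed.
Lemma lcoefM u v k : (u * v) k = \sum_(i \in [set: int]) u i * v (k - i).
Proof. by []. Qed.

Lemma lead_laurent u : u != 0 -> exists2 a, lbound a u & u a != 0.
Proof.
move=> u0; have [b ub] := lcoef_bounded u.
have exn : exists n : nat, u (b - n%:Z) != 0.
  apply/not_existsP => h; move/eqP: u0; apply.
  apply: (laurent_eqP ub) => // n.
  by have /negP := h n; rewrite negbK => /eqP ->.
case: (ex_minnP exn) => m um mmin; exists (b - m%:Z) => // k mk.
have [bk|kb] := ltP b k; first exact: ub.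
apply/eqP/negPn/negP => uk; have := mmin `|b - k|%N.
have -> : b - `|b - k|%N%:Z = k by lia.
by move=> /(_ uk); lia.
Qed.

(* First n coefficients of the power series inverse of sum_i (f i) X^i. *)
Fixpoint linv_seq (f : nat -> F) n : seq F :=
  if n is m.+1 then
    let s := linv_seq f m in
    rcons s ((f 0%N)^-1 * ((m == 0%N)%:R - \sum_(i < m) f i.+1 * s`_(m - i.+1)))
  else [::].

Lemma size_linv_seq f n : size (linv_seq f n) = n.
Proof. by elim: n => //= n IH; rewrite size_rcons IH. Qed.

Lemma nth_linv_seq f n m : (m < n)%N -> (linv_seq f n)`_m = (linv_seq f m.+1)`_m.
Proof.
elim: n => // n IH; rewrite ltnS leq_eqVlt => /predU1P[->//|mn].
by rewrite [LHS]/= nth_rcons size_linv_seq mn IH.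
Qed.

Lemma linv_seqE f n : f 0%N != 0 ->
  \sum_(i < n.+1) f i * (linv_seq f (n - i).+1)`_(n - i) = (n == 0%N)%:R.
Proof.
move=> f0; rewrite big_ord_recl subn0 [X in f 0%N * X]/= nth_rcons size_linv_seq.
rewrite ltnn eqxx mulrA divff// mul1r -[RHS]addr0 -addrA; congr (_ + _).
apply/eqP; rewrite addrC subr_eq0; apply/eqP; apply: eq_bigr => i _.
rewrite lift0; congr (_ * _); rewrite [RHS]nth_linv_seq//.
by have := ltn_ord i; lia.
Qed.

Lemma linv_ex u : u != 0 -> exists v, v * u = 1.
Proof.
move=> /lead_laurent [a ua ua0].
pose f n := u (a - n%:Z).
have f0 : f 0%N != 0 by rewrite /f subr0.
pose g (k : int) : F := if - a - k is Posz n then (linv_seq f n.+1)`_n else 0.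
have gb : lbound (- a) g.
  move=> k ak; rewrite /g; case e : (- a - k) => [n|//].
  by move: ak e; lia.
have gE n : g (- a - n%:Z) = (linv_seq f n.+1)`_n.
  by rewrite /g opprB addrC subrK.
pose v := Laurent (ex_intro (fun b => lbound b g) (- a) gb).
have vb : lbound (- a) v by [].
exists v; rewrite mulrC.
have b1 : lbound 0 (1 : laurent F) by case=> [[|k]|k]//= _; rewrite coef1.
apply: (@laurent_eqP 0) => //.
  by rewrite -[0](subrr a); exact: lmul_bound.
move=> n; rewrite -{1}[0](subrr a) [LHS](lmulE _ ua vb) /=.
under eq_bigr do rewrite gE.
rewrite (linv_seqE n f0) sub0r; case: n => [|n] /=; first by rewrite coef1.
by [].
Qed.

Definition linv u : laurent F := xget 0 [set v | v * u = 1].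

Fact lmulV u : u != 0 -> linv u * u = 1.
Proof. by move=> /linv_ex; exact: (@xgetPex _ 0 [set v | v * u = 1]). Qed.

Fact linv0 : linv 0 = 0.
Proof.
by rewrite /linv; case: xgetP => // v _ /= /eqP; rewrite mulr0 eq_sym oner_eq0.
Qed.

HB.instance Definition _ := GRing.ComNzRing_isField.Build (laurent F) lmulV linv0.

Fact lpoly_is_zmod_morphism : zmod_morphism lpoly.
Proof. by move=> p q; apply: laurentP => -[n|n] /=; rewrite ?coefB ?subr0. Qed.

Fact lpoly_is_monoid_morphism : monoid_morphism lpoly.
Proof.
split=> // p q; apply: laurentP => k.
pose M := (size p + size q)%N.
pose s := [seq i%:Z | i <- iota 0 M].
have us : uniq s by rewrite map_inj_uniq ?iota_uniq// => i j [].
have out i : i \notin s -> lpoly p i = 0.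
  case: i => [i|//] ni /=; rewrite nth_default// leqNgt; apply: contra ni => ip.
  by apply/mapP; exists i; rewrite // mem_iota /= add0n (leq_trans ip)// leq_addr.
rewrite lcoefM (fsbigE s)//; last by move=> i _ /out ->; rewrite mul0r.
rewrite (eq_bigl xpredT) => [|i]; last by rewrite in_setT.
have -> : s = [seq i%:Z | i <- index_iota 0 M] by rewrite /index_iota subn0.
rewrite big_map; case: k => [n|n] /=; last first.
  rewrite big1_seq// => i _; rewrite (_ : Negz n - i%:Z = Negz (n + i)) /= ?mulr0//.
  by rewrite !NegzE; lia.
rewrite coefM -(big_mkord xpredT (fun i => p`_i * q`_(n - i))).
pose G i := p`_i * lpoly_coef q (n%:Z - i%:Z).
have tail N : (N <= maxn M n.+1)%N ->
    (forall i, (N <= i)%N -> G i = 0) ->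
    \sum_(0 <= i < N) G i = \sum_(0 <= i < maxn M n.+1) G i.
  move=> leN GN; rewrite (big_cat_nat (leq0n N) leN) /= [X in _ + X]big_nat_cond.
  by rewrite [X in _ + X]big1 ?addr0// => i /andP[/andP[/GN]].
rewrite -/(G _) (tail M) ?leq_maxl//; last first.
  move=> i iM; rewrite /G nth_default ?mul0r// (leq_trans _ iM)//.
  by rewrite leq_addr.
rewrite -(tail n.+1) ?leq_maxr//; last first.
  move=> i ni; rewrite /G; case e : (n%:Z - i%:Z) => [j|j]; first by lia.
  by rewrite mulr0.
by apply: eq_big_nat => i /andP[_ ni]; rewrite /G subzn.
Qed.

HB.instance Definition _ :=
  GRing.isZmodMorphism.Build {poly F} (laurent F) lpoly lpoly_is_zmod_morphism.
HB.instance Definition _ :=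
  GRing.isMonoidMorphism.Build {poly F} (laurent F) lpoly lpoly_is_monoid_morphism.

Lemma lpoly_eq0 p : (lpoly p == 0) = (p == 0).
Proof.
apply/eqP/eqP => [p0|->]; last by rewrite rmorph0.
by apply/polyP => i; rewrite coef0; have := congr1 (fun u : laurent F => u i) p0.
Qed.

(* The inclusion of F(T) in F((1/T)); [frac (repr x)] is some pair
   (numerator, denominator) representing x. *)
Definition lfrac (x : {fraction {poly F}}) : laurent F :=
  lpoly (frac (repr x)).1 / lpoly (frac (repr x)).2.

Lemma lfrac_pi (x : {ratio {poly F}}) :
  lfrac (\pi_({fraction {poly F}}) x)%qT = lpoly (frac x).1 / lpoly (frac x).2.
Proof.
rewrite /lfrac; set y := repr _; apply/eqP.
rewrite eqr_div ?lpoly_eq0 ?denom_ratioP// -!rmorphM /=.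
by rewrite FracField.equivf_l mulrC.
Qed.


Fact lfrac_is_zmod_morphism : zmod_morphism lfrac.
Proof.
elim/quotW => x; elim/quotW => y.
rewrite -[- _]FracField.pi_opp -[_ + _]FracField.pi_add !lfrac_pi.
have x0 := denom_ratioP x; have y0 := denom_ratioP y.
rewrite /FracField.addf /FracField.oppf !numden_Ratio ?mulf_neq0//.
by rewrite !(rmorphM, rmorphD, rmorphN) /= -mulNr addf_div ?lpoly_eq0//.
Qed.

Lemma lfrac_tofrac (p : {poly F}) : lfrac (@FracField.tofrac _ p) = lpoly p.
Proof.
unlock FracField.tofrac; rewrite lfrac_pi !numden_Ratio ?oner_neq0//.
by rewrite rmorph1 divr1.
Qed.

Fact lfrac_is_monoid_morphism : monoid_morphism lfrac.
Proof.
split; first by have := lfrac_tofrac 1; rewrite !rmorph1.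
elim/quotW => x; elim/quotW => y.
have x0 := denom_ratioP x; have y0 := denom_ratioP y.
rewrite -[_ * _ in LHS]FracField.pi_mul !lfrac_pi.
rewrite /FracField.mulf !numden_Ratio ?mulf_neq0//.
by rewrite !rmorphM mulf_div.
Qed.

HB.instance Definition _ := GRing.isZmodMorphism.Build
  {fraction {poly F}} (laurent F) lfrac lfrac_is_zmod_morphism.
HB.instance Definition _ := GRing.isMonoidMorphism.Build
  {fraction {poly F}} (laurent F) lfrac lfrac_is_monoid_morphism.

(* sum_(n >= 1) a(n) T^(-n); the value a 0 is not used. *)
Definition negpow_coef (a : nat -> F) (k : int) : F :=
  if k is Negz n then a n.+1 else 0.

Lemma negpow_bounded a : exists k0 : int, lbound k0 (negpow_coef a).
Proof. by exists 0 => -[]. Qed.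
Definition negpow_series a := Laurent (negpow_bounded a).

End LaurentField.

(* A sequence (v(n))_{n >= 1} is given by v : nat -> T whose value at 0 is
   ignored, and its kernel elements are shifted by one so as to start at
   index 0: the index m stands for n = m + 1. *)
Definition kernel (T : finType) (r : nat) (v : nat -> T) : set (nat -> T) :=
  [set w | exists i j : nat,
     (j < r ^ i)%N /\ w = (fun m => v (r ^ i * m.+1 + j)%N)].

Definition automatic (T : finType) (r : nat) (v : nat -> T) : Prop :=
  finite_set (kernel r v).

(* Main.v *)
Require Import Defs.
From mathcomp Require Import all_boot all_order all_algebra.
From mathcomp Require Import all_field.
From mathcomp Require Import zify.
From mathcomp Require Import boolp classical_sets cardinality fsbigop.

Set Implicit Arguments.
Unset Strict Implicit.
Unset Printing Implicit Defensive.

Import Defs.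
Import GRing.Theory Num.Theory Order.TTheory.
Local Open Scope ring_scope.

(** The recursion says that beyond index [ell] the entry of index
    [ell + 1 + n] depends only on [n] modulo [r] when [r] does not divide [n],
    and is a multiple of an [r]-th power of an earlier entry when it does.

    Let rho collect the terms of theta whose index [ell + 1 + r m] is of the
    second kind. What remains of theta has eventually periodic coefficients,
    so it is a rational function ([theta_sub_rho_rational]).  In characteristic
    [p], raising a series to the power [r] raises each coefficient to the power
    [r] and stretches the exponents by [r] ([lexp_pchar]).  The term of rho of
    index [ell + 1 + r m] carries the factor alpha of index [m mod k + 1]
    and comes from the entry of index [m + 1].  That entry belongs to rho
    exactly when [m >= ell] and [m = ell] modulo [r], and then [m = ell] modulo
    [k] because [k] divides [r]: so all these terms carry one and the same
    factor gamma.  Hence rho and [gamma T^(r - ell - 1) rho^r] differ only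
    by terms that come from the initial or the periodic entries; their
    difference is again eventually periodic, hence rational ([rho_equation]).
    As gamma is nonzero, this is a nontrivial algebraic equation for rho.

    Automaticity is read off the recursion.  The sequence
    [m |-> lambda (p^i m + c)] with [i] large is either constant, or the image
    under a map [F -> F] of [m |-> lambda (p^(i-t) m + c')] with [c'] about
    [c / r]: dividing by [r] keeps the offset within a bounded factor of the
    step.  Descending to a bounded [i] leaves finitely many steps, offsets and
    maps ([kernel_reduction]). *)

(** * Powers and rationality of series in 1/T *)

Section LaurentSeries.
Variable F : fieldType.
Implicit Types (u v : laurent F) (a k : int).

Lemma lmonom_bounded (c : F) a :
  exists k0 : int, lbound k0 (fun k => if k == a then c else 0).
Proof. by exists a => k ak; rewrite gt_eqF. Qed.

Definition lmonom c a := Laurent (lmonom_bounded c a).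

Lemma lcoef_lmonomM c a u k : (lmonom c a * u) k = c * u (k - a).
Proof.
rewrite lcoefM (fsbigE [:: a])//=; last first.
  by move=> i _; rewrite inE => /negPf ->; rewrite mul0r.
by rewrite big_cons big_nil in_setT addr0 eqxx.
Qed.

Lemma lmonomM c d a b : lmonom c a * lmonom d b = lmonom (c * d) (a + b).
Proof.
apply: laurentP => k; rewrite lcoef_lmonomM /= subr_eq [b + a]addrC.
by case: eqP => // _; rewrite mulr0.
Qed.

Lemma lmonom_lpoly c (n : nat) : lmonom c n = lpoly (c *: 'X^n).
Proof.
apply: laurentP => -[m|m] //=.
by rewrite coefZ coefXn eqz_nat; case: eqP => _; rewrite ?mulr1 ?mulr0.
Qed.

Lemma lcoef_XnM n u k : (lpoly 'X^n * u) k = u (k - n%:Z).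
Proof.
by rewrite -['X^n]scale1r -lmonom_lpoly lcoef_lmonomM mul1r.
Qed.

Lemma lmonom10 : lmonom (1 : F) 0 = 1.
Proof. by rewrite (lmonom_lpoly 1 0) expr0 scale1r rmorph1. Qed.

Lemma lmonomX c a n : lmonom c a ^+ n = lmonom (c ^+ n) (a * n%:Z).
Proof.
elim: n => [|n IHn]; first by rewrite !expr0 mulr0 lmonom10.
by rewrite exprS IHn lmonomM -exprS; congr lmonom; lia.
Qed.

Lemma lmonom_rational c a : exists C, lmonom c a = lfrac C.
Proof.
pose m := `|a|%N; have m0 : lpoly ('X^m : {poly F}) != 0.
  by rewrite lpoly_eq0 -size_poly_eq0 size_polyXn.
have [n nE] : exists n : nat, a + m%:Z = n by exists (absz (a + m%:Z)); lia.
exists (@FracField.tofrac _ (c *: 'X^n) / @FracField.tofrac _ 'X^m).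
rewrite fmorph_div /= !lfrac_tofrac; apply: (mulIf m0); rewrite divfK//.
rewrite -[X in _ * lpoly X]scale1r -!lmonom_lpoly lmonomM mulr1.
by rewrite nE.
Qed.

Lemma lbound_exp a u n : lbound a u -> lbound (a * n%:Z) (u ^+ n).
Proof.
move=> ua; elim: n => [|n IHn].
  by rewrite mulr0 expr0 -lmonom10 => k k0 /=; rewrite gt_eqF.
have -> : a * n.+1%:Z = a + a * n%:Z by lia.
by rewrite exprS; apply: lmul_bound.
Qed.

(** Peeling off the leading term with the additivity of the [r]-th power
    lowers the degree bound of both sides, until the bound passes below the
    exponent under consideration and both coefficients vanish. *)
Lemma lexp_pchar (p r : nat) u k : p \in [pchar F] -> p.-nat r ->
  (u ^+ r) k = if (r%:Z %| k)%Z then u (k %/ r%:Z)%Z ^+ r else 0.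
Proof.
move=> pF pr; have r_gt0 : (0 < r)%N by case/andP: pr.
have prL : [pchar (laurent F)].-nat r.
  have pL := rmorph_pchar (@lpoly F) (rmorph_pchar (@polyC F) pF).
  by rewrite (eq_pnat _ (pcharf_eq pL)).
have dvd_coef (j : int) : (r%:Z %| j)%Z ->
  exists2 j', j = j' * r%:Z & (j %/ r%:Z)%Z = j'.
  by case/dvdzP => j' ->; exists j'; rewrite // mulzK //; lia.
have [a ua] := lcoef_bounded u.
(* [n] counts the leading terms to be peeled off before the bound is below [k];
   its value does not matter as long as it is large enough. *)
suff H n b v : lbound b v -> (b - n%:Z) * r%:Z < k ->
    (v ^+ r) k = if (r%:Z %| k)%Z then v (k %/ r%:Z)%Z ^+ r else 0.
  apply: (H (`|a| + `|k| + 1)%N a) => //; nia.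
elim: n b v => [|n IHn] b v vb ltk.
  rewrite subr0 in ltk; rewrite (lbound_exp vb) //.
  case: ifP => // /dvd_coef[j e ->]; rewrite vb ?expr0n ?eqn0Ngt ?r_gt0 //.
  nia.
pose w := v - lmonom (v b) b.
have wb : lbound (b - 1) w.
  move=> j bj; rewrite lcoefD lcoefN /=; case: eqP => [->|/eqP jb]; first by rewrite subrr.
  by rewrite subr0 vb//; lia.
have wE j : w j = v j - (if j == b then v b else 0) by [].
have vE : v = w + lmonom (v b) b by rewrite subrK.
clearbody w; rewrite {1}vE exprDn_pchar // [LHS]lcoefD lmonomX (IHn (b - 1)) //; last by lia.
case: ifP => [/dvd_coef[j e ->]|ndvd]; rewrite /=.
  have -> : (k == b * r%:Z) = (j == b).
    by rewrite e; apply/eqP/eqP => [|->//]; nia.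
  rewrite wE; case: (j =P b) => [->|_]; last by rewrite subr0 addr0.
  by rewrite subrr expr0n eqn0Ngt r_gt0 add0r.
rewrite ifF ?addr0 //; apply/negP => /eqP kb.
by move: ndvd; rewrite kb dvdz_mull.
Qed.

(** Multiplying by [T^N - 1] kills all but finitely many coefficients, and a
    further power of [T] makes the product a polynomial. *)
Lemma periodic_rational u (K : int) (N : nat) : (0 < N)%N ->
    (forall k, k < K -> u (k - N%:Z) = u k) ->
  exists B, u = lfrac B.
Proof.
move=> N0 uper; have [a ua] := lcoef_bounded u.
pose M := `|K|%N; pose Q : {poly F} := 'X^(M + N) - 'X^M.
pose P : {poly F} := \poly_(i < (`|a| + N + M).+1) (lpoly Q * u) i%:Z.
have Qu k : (lpoly Q * u) k = u (k - (M + N)%:Z) - u (k - M%:Z).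
  by rewrite [lpoly Q]rmorphB mulrBl lcoefD lcoefN !lcoef_XnM.
have Q0 : lpoly Q != 0.
  rewrite lpoly_eq0 subr_eq0; apply/eqP => /(congr1 (fun q : {poly F} => size q)).
  by rewrite !size_polyXn; lia.
exists (@FracField.tofrac _ P / @FracField.tofrac _ Q).
rewrite fmorph_div /= !lfrac_tofrac; apply: (mulIf Q0); rewrite divfK // mulrC.
apply: laurentP => -[n|n]; rewrite ?[RHS]/= ?coef_poly.
  case: ltnP => // nbig; rewrite Qu !ua ?subrr//; lia.
rewrite Qu; apply/eqP; rewrite subr_eq0; apply/eqP.
rewrite -(uper (Negz n - M%:Z)); last by rewrite /M; lia.
by congr (u _); lia.
Qed.

Lemma periodic_negpow_rational (c : nat -> F) (n0 N : nat) : (0 < N)%N ->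
    (forall n, (n0 <= n)%N -> c (n + N)%N = c n) ->
  exists B, negpow_series c = lfrac B.
Proof.
move=> N0 cper; apply: (@periodic_rational _ (- n0%:Z) N) => // -[n|n] kn /=.
  by lia.
have -> : Negz n - N%:Z = Negz (n + N) by lia.
by rewrite /= -addSn cper //; lia.
Qed.

End LaurentSeries.

Lemma affine_power_algebraic (E L : fieldType) (f : {rmorphism E -> L})
    (b c : E) (x : L) (n : nat) :
  (1 < n)%N -> c != 0 -> x = f b + f c * x ^+ n -> algebraicOver f x.
Proof.
move=> n1 c0 xE; exists (b%:P + c *: 'X^n - 'X).
  apply/eqP => /(congr1 (fun q : {poly E} => q`_n)).
  rewrite !coefB coefD coefC coefZ coefXn coefX coef0 eqxx mulr1.
  have -> : (n == 0%N) = false by lia.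
  have -> : (n == 1%N) = false by lia.
  by rewrite add0r subr0 => /eqP; rewrite (negPf c0).
rewrite rmorphB rmorphD /= map_polyC map_polyZ map_polyXn map_polyX.
rewrite /root hornerD hornerN hornerD hornerZ hornerXn hornerX hornerC /=.
by rewrite -xE subrr.
Qed.

(** * The recursive sequence *)

Section Recursion.
Variables (F : fieldType) (ell p t k : nat) (alpha beta lambda : nat -> F).
Let r := (p ^ t)%N.
Hypotheses (p_prime : prime p) (t_gt0 : (0 < t)%N).
Hypothesis k_dvd_r : (k %| r)%N.
Hypothesis lambda_frob : forall n,
  lambda (ell + 1 + r * n)%N = alpha (n %% k + 1)%N * lambda n.+1 ^+ r.
Hypothesis lambda_beta : forall m j, (1 <= j < r)%N ->
  lambda (ell + 1 + r * m + j)%N = beta j.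

Let r_gt1 : (1 < r)%N.
Proof. by rewrite -(exp1n t) ltn_exp2r // prime_gt1. Qed.

Lemma lambda_nondvd n : ~~ (r %| n)%N -> lambda (ell + 1 + n)%N = beta (n %% r)%N.
Proof.
move=> ndvd; rewrite {1}(divn_eq n r) [(_ * r)%N]mulnC addnA lambda_beta //.
by rewrite ltn_mod (ltnW r_gt1) andbT lt0n.
Qed.

Definition rho_coef n : F :=
  if (ell < n)%N && (r %| n - ell.+1)%N then lambda n else 0.

Lemma theta_sub_rho_rational :
  exists A, negpow_series lambda - negpow_series rho_coef = lfrac A.
Proof.
have [|n|A AE] := @periodic_negpow_rational F
  (fun n => lambda n - rho_coef n) ell.+1 r; first exact: ltnW.
  move=> nell; rewrite /rho_coef nell ltn_addr //= -(subnKC nell) addKn.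
  rewrite -addnA addKn dvdn_addl //; case: ifP => dvd_n; first by rewrite !subrr.
  by rewrite !subr0 -(addn1 ell) !lambda_nondvd ?dvdn_addl ?addn1 ?dvd_n // modnDr.
exists A; rewrite -AE; apply: laurentP => -[n|n]; rewrite lcoefD lcoefN //=.
by rewrite subr0.
Qed.

Let gamma := alpha (ell %% k + 1)%N.

(** The coefficient of [rho - gamma T^(r - ell - 1) rho^r] at the power
    [-(ell + 1 + r m)] of [T]. *)
Let rem_coef m := alpha (m %% k + 1)%N * lambda m.+1 ^+ r
                - gamma * rho_coef m.+1 ^+ r.

(** If [m = ell] modulo [r] both terms agree; otherwise the entry of rho is 0
    and that of lambda is one of the periodic values. *)
Lemma rem_coef_periodic m : (ell <= m)%N -> rem_coef (m + r)%N = rem_coef m.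
Proof.
move=> ellm; rewrite /rem_coef /rho_coef !ltnS !subSS ellm.
rewrite (leq_trans ellm (leq_addr _ _)) /= -(subnKC ellm) -addnA !addKn.
set d := (m - ell)%N; rewrite dvdn_addl //; case: ifP => dvd_d.
  have modk e : (r %| e)%N -> ((ell + e) %% k = ell %% k)%N.
    move=> re; have /dvdnP[c ->] := dvdn_trans k_dvd_r re.
    by rewrite addnC modnMDl.
  by rewrite !modk ?dvdn_addl // /gamma !subrr.
rewrite expr0n eqn0Ngt ltnW // mulr0 !subr0; congr (alpha (_ + 1)%N * _ ^+ r).
  by have /dvdnP[c ->] := k_dvd_r; rewrite addnA addnC modnMDl.
have shift e : (ell + e).+1 = (ell + 1 + e)%N by lia.
by rewrite !shift !lambda_nondvd ?dvdn_addl ?dvd_d // modnDr.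
Qed.

(** With [C = gamma T^(r - ell - 1)], the series [rho - C rho^r] is supported at
    exponents that step by [r], where its coefficients [rem_coef m] eventually
    have period [r]; so all its coefficients eventually have period [r * r]. *)
Lemma rho_equation : p \in [pchar F] -> gamma != 0 ->
  let rho := negpow_series rho_coef in
  exists B C, C != 0 /\ rho = lfrac B + lfrac C * rho ^+ r.
Proof.
move=> pF gamma_neq0 rho.
have pr : p.-nat r by rewrite pnatX pnat_id.
set C := lmonom gamma (r%:Z - ell.+1%:Z).
have rhoE n : (rho - C * rho ^+ r) (- (ell + 1 + n)%N%:Z) =
    if (r %| n)%N then rem_coef (n %/ r)%N else 0.
  have -> : (- (ell + 1 + n)%N%:Z) = Negz (ell + n) by lia.
  rewrite lcoefD lcoefN lcoef_lmonomM (lexp_pchar _ _ pF pr) /=.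
  rewrite /rho_coef ltnS leq_addr subSS addKn /=.
  have -> : Negz (ell + n) - (r%:Z - ell.+1%:Z) = - (n + r)%N%:Z by lia.
  rewrite dvdzE abszN !absz_nat dvdn_addl //; case: ifP => [/dvdnP[m ->]|_]; last first.
    by rewrite mulr0 subr0.
  rewrite mulnK ?(ltnW r_gt1) // /rem_coef -lambda_frob.
  have -> : (- (m * r + r)%N%:Z = Negz m * r%:Z) by lia.
  rewrite mulzK /=; last by lia.
  by congr (lambda _ - _); lia.
have [|j|B BE] := @periodic_rational _ (rho - C * rho ^+ r)
  (- (ell + 1 + r * ell)%N%:Z) (r * r)%N.
- by rewrite muln_gt0 ltnW.
- move=> jlt; pose n := absz (j + (ell + 1)%N%:Z).
  have -> : j = - (ell + 1 + n)%N%:Z by rewrite /n; lia.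
  have -> : - (ell + 1 + n)%N%:Z - (r * r)%N%:Z = - (ell + 1 + (n + r * r))%N%:Z by lia.
  rewrite !rhoE dvdn_addl ?dvdn_mulr //; case: ifP => // rn.
  rewrite divnDr ?dvdn_mulr // mulnK ?(ltnW r_gt1) // rem_coef_periodic //.
  by rewrite leq_divRL ?(ltnW r_gt1) //; rewrite /n; lia.
have [c cE] := lmonom_rational gamma (r%:Z - ell.+1%:Z).
exists B, c; rewrite -cE -/C -BE subrK; split=> //.
rewrite -(fmorph_eq0 (@lfrac F)) /= -cE; apply/eqP.
move=> /(congr1 (fun u : laurent F => u (r%:Z - ell.+1%:Z))) /=.
by rewrite eqxx => /eqP; rewrite (negPf gamma_neq0).
Qed.

(** The two bounds on [c] are those preserved by [c |-> (c - ell - 1) / r + 1]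
    together with [i |-> i - t].  The lower one keeps the index beyond
    [ell] as long as [2 * ell < p ^ i], so that the recursion applies already
    at [m = 0]; [2 * t <= i] makes [k] divide [p ^ (i - t)], so that the factor
    alpha does not depend on [m]. *)
Lemma kernel_reduction base i c : (2 * t + 2 * ell < base)%N ->
  (p ^ i <= c + ell)%N -> (c <= 2 * p ^ i + 1)%N ->
  exists (g : F -> F) i0 c0,
    [/\ (i0 <= base)%N, (c0 <= 2 * p ^ base + 1)%N &
        forall m, lambda (p ^ i * m + c)%N = g (lambda (p ^ i0 * m + c0)%N)].
Proof.
move=> baseP; have p_gt1 := prime_gt1 p_prime.
have [n] := ubnP i; elim: n i c => // n IHn i c; rewrite ltnS => leq_in lo hi.
have [small|big] := leqP i base.
  exists id, i, c; split=> //.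
  by rewrite (leq_trans hi) // leq_add2r leq_mul2l leq_exp2l.
have pi : (p ^ i = r * p ^ (i - t))%N by rewrite -expnD; congr expn; lia.
have pbig : (base < p ^ i)%N by apply: leq_trans big _; exact: ltnW (ltn_expl _ _).
have kdvd : (k %| p ^ (i - t))%N.
  by apply: dvdn_trans k_dvd_r _; apply: dvdn_exp2l; lia.
pose d := (c - (ell + 1))%N.
have cE : c = (ell + 1 + d)%N by rewrite /d; lia.
have idx m : (p ^ i * m + c = ell + 1 + (r * (p ^ (i - t) * m) + d))%N.
  by rewrite pi cE; lia.
have [rd|rd] := boolP (r %| d)%N; last first.
  exists (fun=> beta (d %% r)%N), 0%N, 0%N; split=> // m.
  by rewrite idx lambda_nondvd ?dvdn_addr ?dvdn_mulr // mulnC modnMDl.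
have [d' dE] := dvdnP rd.
have [|||g [i0 [c0 [i0b c0b gE]]]] := IHn (i - t)%N d'.+1.
- by lia.
- by nia.
- by nia.
exists (fun x => alpha (d' %% k + 1)%N * g x ^+ r), i0, c0; split=> // m.
rewrite -gE idx dE [(d' * r)%N]mulnC -mulnDr lambda_frob -addnS.
congr (alpha (_ + 1)%N * _).
by have /dvdnP[e ->] := kdvd; rewrite mulnAC modnMDl.
Qed.

End Recursion.

(** A kernel member has step [p ^ i] and, with [m] counted from 0, offset
    [p ^ i + j < 2 * p ^ i], within the bounds of [kernel_reduction]. *)
Lemma recursion_automatic (F : finFieldType) (ell p t k : nat)
    (alpha beta lambda : nat -> F) : prime p -> (0 < t)%N -> (k %| p ^ t)%N ->
    (forall n, lambda (ell + 1 + p ^ t * n)%N =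
       alpha (n %% k + 1)%N * lambda n.+1 ^+ (p ^ t)) ->
    (forall m j, (1 <= j < p ^ t)%N ->
       lambda (ell + 1 + p ^ t * m + j)%N = beta j) ->
  automatic p lambda.
Proof.
move=> p_prime t_gt0 k_dvd frobE betaE.
pose base := (2 * t + 2 * ell + 1)%N; pose M := (2 * p ^ base + 1)%N.
pose W (x : {ffun F -> F} * ('I_base.+1 * 'I_M.+1)) m :=
  x.1 (lambda (p ^ x.2.1 * m + x.2.2)%N).
apply: (@sub_finite_set _ _ (range W)); last exact/finite_image/finite_finset.
move=> _ [i [j [ji ->]]].
have [|||g [i0 [c0 [i0b c0b gE]]]] :=
  @kernel_reduction _ _ _ _ _ _ _ _ p_prime t_gt0 k_dvd frobE betaE
    base i (p ^ i + j)%N; try by rewrite ?/base; lia.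
exists (finfun g, (Ordinal (i0b : (i0 < base.+1)%N),
                   Ordinal (c0b : (c0 < M.+1)%N))) => //.
by apply/funext => m; rewrite /W /= ffunE -gE mulnS; congr lambda; lia.
Qed.

Theorem theorem2 (ell p s t q r k : nat) (F : finFieldType)
    (lambda0 : ell.-tuple F) (alpha beta : nat -> F) (lambda : nat -> F) :
  (1 <= ell)%N -> prime p -> (1 <= s)%N -> (1 <= t)%N ->
  q = (p ^ s)%N -> r = (p ^ t)%N -> #|F| = q ->
  (1 <= k)%N -> (k %| r)%N ->
  (forall i : nat, (1 <= i <= k)%N -> alpha i != 0) ->
  (forall i : 'I_ell, lambda i.+1 = tnth lambda0 i) ->
  (forall m i : nat, (i < k)%N ->
     lambda (ell + 1 + r * (k * m + i))%N =
     alpha (i + 1)%N * lambda (k * m + i + 1)%N ^+ r) ->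
  (forall m j : nat, (1 <= j < r)%N ->
     lambda (ell + 1 + r * m + j)%N = beta j) ->
  let theta := negpow_series lambda in
  [/\ exists (A B C : {fraction {poly F}}) (rho : laurent F),
        [/\ C != 0,
            theta = lfrac A + rho &
            rho = lfrac B + lfrac C * rho ^+ r],
      algebraicOver (@lfrac F) theta &
      automatic p lambda].
Proof.
move=> _ p_prime _ t_gt0 -> -> cardF k_gt0 k_dvd alpha_neq0 _ frob0 betaE theta.
have pF := card_finPcharP cardF p_prime.
have frob n : lambda (ell + 1 + p ^ t * n)%N =
    alpha (n %% k + 1)%N * lambda n.+1 ^+ (p ^ t).
  rewrite {1}(divn_eq n k) [(_ * k)%N]mulnC frob0 ?ltn_mod //.
  by rewrite [(k * _)%N]mulnC -divn_eq !addn1.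
have gamma_neq0 : alpha (ell %% k + 1)%N != 0.
  by apply: alpha_neq0; rewrite addn1 /= ltn_mod.
have [A AE] := theta_sub_rho_rational p_prime t_gt0 betaE.
have [B [C [C0 rhoE]]] :=
  rho_equation p_prime t_gt0 k_dvd frob betaE pF gamma_neq0.
have thetaE : theta = lfrac A + negpow_series (rho_coef ell p t lambda).
  by rewrite -AE subrK.
split; last exact: recursion_automatic frob betaE.
  by exists A, B, C, (negpow_series (rho_coef ell p t lambda)).
rewrite thetaE; apply: algebraic_add; first exact: algebraic_id.
by apply: affine_power_algebraic rhoE; rewrite // -(exp1n t) ltn_exp2r // prime_gt1.
Qed.
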